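(* A Banach space $E$ is linearly isomorphic to a Banach lattice if and only if there is a norm-closed ideal $I$ in $\mathrm{FBL}[E]$ such that $\mathrm{FBL}[E]=\delta_E(E)\oplus I$. More precisely, if $X$ is a Banach lattice and $T:E\to X$ is a linear isomorphism onto $X$, then $\mathrm{FBL}[E]=\delta_E(E)\oplus \ker(\widehat T)$.
   Context: All spaces are real. An ideal of a Banach lattice is a linear subspace $I$ such that $|x|\leq |y|$ and $y\in I$ imply $x\in I$. The symbol $\oplus$ denotes a direct sum decomposition of a Banach space into two closed subspaces. The free Banach lattice generated by a Banach space $E$ is a Banach lattice $\mathrm{FBL}[E]$ together with a linear isometric embedding $\delta_E:E\to \mathrm{FBL}[E]$ such that for every Banach lattice $X$ and every bounded linear operator $T:E\to X$ there is a unique lattice homomorphism $\widehat T:\mathrm{FBL}[E]\to X$ with $\widehat T\delta_E=T$, and moreover $\|\widehat T\|=\|T\|$. It exists and is unique up to lattice isometry. Concretely, it is the closed sublattice generated by the functions $\delta_E(x):E^*\to\mathbb R$, $\delta_E(x)(x^* )=x^*(x)$ ($x\in E$), in the Banach lattice (with pointwise order) of positively homogeneous functions $f:E^*\to\mathbb R$ with finite norm $\|f\|=\sup\{\sum_{k=1}^n|f(x_k^* )| : n\in\mathbb N,\ x_1^*,\dots,x_n^*\in E^*,\ \sup_{x\in B_E}\sum_{k=1}^n|x_k^*(x)|\leq 1\}$. *)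

(* Defs.v *)
From HB Require Import structures.
From mathcomp Require Import all_boot all_order all_algebra.
From mathcomp Require Import all_classical all_reals all_analysis.
Import Order.TTheory GRing.Theory Num.Theory.
Import numFieldNormedType.Exports.

Set Implicit Arguments.
Unset Strict Implicit.
Unset Printing Implicit Defensive.

Local Open Scope classical_set_scope.
Local Open Scope ring_scope.

(* The order is a field of the mixin instead of an Order.Lattice instance:
   Hierarchy Builder rejects the join of Order.Lattice and CompleteNormedModule
   because of the number structures, which already inherit from both sides.
   The notation `|x| always denotes the norm; the lattice absolute value
   x \/ -x is labs x below. *)
HB.mixin Record isBanachLattice (R : realType) X & CompleteNormedModule R X := {
  lle : rel X ;
  ljoin : X -> X -> X ;
  lmeet : X -> X -> X ;
  lle_refl : reflexive lle ;
  lle_anti : antisymmetric lle ;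
  lle_trans : transitive lle ;
  ljoin_le : forall x y z : X, lle (ljoin x y) z = lle x z && lle y z ;
  le_lmeet : forall x y z : X, lle z (lmeet x y) = lle z x && lle z y ;
  lle_add : forall x y z : X, lle x y -> lle (x + z) (y + z) ;
  lle_scale : forall (a : R) (x : X), 0 <= a -> lle 0 x -> lle 0 (a *: x) ;
  lnorm_le : forall x y : X,
    lle (ljoin x (- x)) (ljoin y (- y)) -> `|x| <= `|y|
}.

#[short(type="banachLatticeType")]
HB.structure Definition BanachLattice (R : realType) :=
  {X of isBanachLattice R X & CompleteNormedModule R X}.

Section definitions.
Context {R : realType}.

Definition labs {X : banachLatticeType R} (x : X) : X := ljoin x (- x).

Definition lattice_hom {X Y : banachLatticeType R} (f : {linear X -> Y}) :
    Prop :=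
  {morph f : x y / ljoin x y} /\ {morph f : x y / lmeet x y}.

Definition linear_subspace {V : lmodType R} (S : set V) : Prop :=
  S 0 /\ forall (a : R) (x y : V), S x -> S y -> S (a *: x + y).

Definition lattice_ideal {X : banachLatticeType R} (I : set X) : Prop :=
  linear_subspace I /\ forall x y : X, lle (labs x) (labs y) -> I y -> I x.

Definition direct_sum {V : completeNormedModType R} (U W : set V) : Prop :=
  [/\ linear_subspace U /\ closed U, linear_subspace W /\ closed W,
      U `&` W = [set 0] &
      forall v : V, exists u w : V, [/\ U u, W w & v = u + w]].

Definition linear_kernel {V W : lmodType R} (f : {linear V -> W}) : set V :=
  f @^-1` [set 0].

(* Extended-real valued, so that it is finite exactly for bounded operators. *)
Definition opnorm {V W : normedModType R} (f : {linear V -> W}) : \bar R :=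
  ereal_sup [set (`|f x|)%:E | x in [set x : V | `|x| <= 1]].

Definition linear_isomorphism {V W : normedModType R} (T : {linear V -> W}) :
    Prop :=
  continuous T /\
  exists S : W -> V, [/\ cancel T S, cancel S T & continuous S].

(* The pair (F, delta) is a model of FBL[E]. Boundedness of a linear operator
   is expressed as continuity. *)
Definition is_free_banach_lattice (E : completeNormedModType R)
    (F : banachLatticeType R) (delta : {linear E -> F}) : Prop :=
  (forall x : E, `|delta x| = `|x|) /\
  forall (X : banachLatticeType R) (T : {linear E -> X}), continuous T ->
    exists That : {linear F -> X},
      [/\ lattice_hom That, That \o delta =1 T, opnorm That = opnorm T &
          forall S : {linear F -> X},
            lattice_hom S -> S \o delta =1 T -> S =1 That].

End definitions.

(* Main.v *)
(* If T : E -> X is an isomorphism onto a Banach lattice, delta T^-1 That is a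
   bounded projection of FBL[E] onto delta(E) whose kernel is the closed ideal
   ker That; That is bounded because it is the unique, norm preserving extension
   of T. Conversely, if FBL[E] = delta(E) (+) I, the projection onto delta(E)
   along I is bounded by the closed graph theorem, so E is isomorphic to the
   quotient FBL[E] / I, a Banach lattice because I is a closed ideal. *)
From HB Require Import structures.
Require Import Defs.
From mathcomp Require Import all_boot all_order all_algebra.
From mathcomp Require Import ring.
From mathcomp Require Import all_classical all_reals all_analysis.
Import Order.TTheory GRing.Theory Num.Theory.
Import numFieldNormedType.Exports.

Local Open Scope classical_set_scope.
Local Open Scope ring_scope.

(** * Order and lattice identities in a Banach lattice *)

Section BanachLatticeTheory.
Context {R : realType} {X : banachLatticeType R}.
Implicit Types (x y z : X) (a : R).

Lemma le_ljoinl x y : lle x (ljoin x y).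
Proof. by have := ljoin_le x y (ljoin x y); rewrite lle_refl => /esym/andP[]. Qed.

Lemma le_ljoinr x y : lle y (ljoin x y).
Proof. by have := ljoin_le x y (ljoin x y); rewrite lle_refl => /esym/andP[]. Qed.

Lemma ljoin_lub x y z : lle x z -> lle y z -> lle (ljoin x y) z.
Proof. by move=> xz yz; rewrite ljoin_le xz. Qed.

Lemma lle_eq x y : lle x y -> lle y x -> x = y.
Proof. by move=> xy yx; apply: lle_anti; rewrite xy. Qed.

Lemma ljoinC x y : ljoin x y = ljoin y x.
Proof. by apply: lle_eq; apply: ljoin_lub; rewrite ?le_ljoinl ?le_ljoinr. Qed.

Lemma ljoinA x y z : ljoin x (ljoin y z) = ljoin (ljoin x y) z.
Proof.
apply: lle_eq; rewrite !ljoin_le.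
- rewrite (lle_trans _ _ _ (le_ljoinl _ _) (le_ljoinl _ _)) le_ljoinr !andbT.
  exact: lle_trans _ _ _ (le_ljoinr _ _) (le_ljoinl _ _).
- rewrite le_ljoinl /= (lle_trans _ _ _ (le_ljoinl _ _) (le_ljoinr _ _)).
  exact: lle_trans _ _ _ (le_ljoinr _ _) (le_ljoinr _ _).
Qed.

Lemma ljoinxx x : ljoin x x = x.
Proof. by apply: lle_eq; rewrite ?le_ljoinl// ljoin_lub ?lle_refl. Qed.

Lemma ljoin_idPr x y : lle x y <-> ljoin x y = y.
Proof.
split=> [xy|<-]; last exact: le_ljoinl.
by apply: lle_eq; rewrite ?le_ljoinr// ljoin_lub ?lle_refl.
Qed.

Lemma lle_addr_cancel z x y : lle (x + z) (y + z) = lle x y.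
Proof.
apply/idP/idP; last exact: lle_add.
by move=> /(lle_add _ _ (- z)); rewrite !addrK.
Qed.

Lemma ljoinDr x y z : ljoin (x + z) (y + z) = ljoin x y + z.
Proof.
apply: lle_eq; first by rewrite ljoin_lub// lle_addr_cancel ?le_ljoinl ?le_ljoinr.
rewrite -(lle_addr_cancel (- z)) addrK ljoin_le.
by rewrite -![lle _ (_ - z)](lle_addr_cancel z) subrK le_ljoinl le_ljoinr.
Qed.

Lemma lle_subr_ge0 x y : lle 0 (y - x) = lle x y.
Proof. by rewrite -(lle_addr_cancel x) add0r subrK. Qed.

Lemma lle_opp x y : lle (- x) (- y) = lle y x.
Proof. by rewrite -lle_subr_ge0 opprK addrC lle_subr_ge0. Qed.

Lemma lle_scaler a x y : 0 <= a -> lle x y -> lle (a *: x) (a *: y).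
Proof.
move=> a0; rewrite -lle_subr_ge0 -[in X in _ -> X]lle_subr_ge0.
by rewrite -scalerBr; exact: lle_scale.
Qed.

Lemma ljoinZ a x y : 0 <= a -> ljoin (a *: x) (a *: y) = a *: ljoin x y.
Proof.
rewrite le_eqVlt => /predU1P[<-|a0]; first by rewrite !scale0r ljoinxx.
apply: lle_eq.
  by apply: ljoin_lub; apply: lle_scaler; rewrite ?ltW ?le_ljoinl ?le_ljoinr.
have aV0 : 0 <= a^-1 by rewrite invr_ge0 ltW.
(* The reverse inequality is the easy one, applied to the scalar [a^-1]. *)
rewrite -[X in lle _ X](scalerKV (lt0r_neq0 a0)).
apply: lle_scaler; rewrite ?ltW// ljoin_le.
have aVK z : z = a^-1 *: (a *: z) by rewrite scalerK ?gt_eqF.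
by apply/andP; split; [rewrite {1}[x]aVK|rewrite {1}[y]aVK];
  apply: lle_scaler => //; rewrite ?le_ljoinl ?le_ljoinr.
Qed.

Lemma le_labs x : lle x (labs x).
Proof. exact: le_ljoinl. Qed.

Lemma leN_labs x : lle (- x) (labs x).
Proof. exact: le_ljoinr. Qed.

Lemma lleD x y z t : lle x y -> lle z t -> lle (x + z) (y + t).
Proof.
move=> xy zt; apply: (@lle_trans _ _ (y + z)); first exact: lle_add.
by rewrite ![y + _]addrC; exact: lle_add.
Qed.

Lemma labs_ge0 x : lle 0 (labs x).
Proof.
have half0 : 0 <= 2^-1 :> R by rewrite invr_ge0.
(* Adding the bounds on [x] and [- x] gives twice [labs x], which is then halved. *)
have := lleD _ _ _ _ (le_labs x) (leN_labs x); rewrite subrr => x2.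
have := lle_scale _ _ half0 x2.
by rewrite scalerDr -scalerDl -div1r -splitr scale1r.
Qed.

Lemma ger0_labs x : lle 0 x -> labs x = x.
Proof.
move=> x0; rewrite /labs ljoinC; apply/ljoin_idPr.
by apply: (lle_trans _ _ _ _ x0); rewrite -oppr0 lle_opp.
Qed.

(** Birkhoff's inequality: each of [x], [y] is below [ljoin x' y'] plus the right-hand side, hence
    so is their join; exchanging the two pairs gives the other sign. *)
Lemma labs_ljoinB x x' y y' :
  lle (labs (ljoin x y - ljoin x' y')) (labs (x - x') + labs (y - y')).
Proof.
have half (u v u' v' : X) :
    lle (ljoin u v - ljoin u' v') (labs (u - u') + labs (v - v')).
  rewrite -(lle_addr_cancel (ljoin u' v')) subrK.
  apply: ljoin_lub.
  - rewrite -[X in lle X _](subrK u'); apply: lleD; last exact: le_ljoinl.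
    by rewrite -[X in lle X _]addr0; apply: lleD; [exact: le_labs|exact: labs_ge0].
  - rewrite -[X in lle X _](subrK v'); apply: lleD; last exact: le_ljoinr.
    by rewrite -[X in lle X _]add0r; apply: lleD; [exact: labs_ge0|exact: le_labs].
apply: ljoin_lub => //; rewrite opprB.
have labsBC (u v : X) : labs (u - v) = labs (v - u).
  by rewrite /labs !opprB ljoinC.
by rewrite (labsBC x) (labsBC y).
Qed.

End BanachLatticeTheory.

(** * Ideals and kernels of lattice homomorphisms *)

Lemma ideal_labs {R : realType} {X : banachLatticeType R} (I : set X) (x : X) :
  lattice_ideal I -> I x -> I (labs x).
Proof.
by move=> [_ idI]; apply: idI; rewrite (ger0_labs (labs x)) ?labs_ge0 ?lle_refl.
Qed.

(** Birkhoff's inequality and solidity of [I]; this makes the join well defined modulo [I]. *)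
Lemma ideal_ljoinB {R : realType} {X : banachLatticeType R} (I : set X)
    (x x' y y' : X) : lattice_ideal I -> I (x - x') -> I (y - y') ->
  I (ljoin x y - ljoin x' y').
Proof.
move=> idI Ix Iy; have [[_ linI] solidI] := idI.
apply: (solidI _ (labs (x - x') + labs (y - y'))).
  rewrite (ger0_labs (labs _ + _)); first exact: labs_ljoinB.
  by rewrite -[0]addr0; apply: lleD; exact: labs_ge0.
by rewrite -[labs (x - x')]scale1r; apply: linI; apply: ideal_labs.
Qed.

Lemma ker_lattice_hom_ideal {R : realType} {X Y : banachLatticeType R}
  (f : {linear X -> Y}) : lattice_hom f -> lattice_ideal (linear_kernel f).
Proof.
move=> [fjoin _]; split; first split; rewrite /linear_kernel /=.
- by rewrite linear0.
- by move=> a x y fx fy; rewrite linearP fx fy scaler0 addr0.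
move=> x y xy fy; apply/eqP; rewrite -normr_le0.
(* Since [f] preserves joins, it preserves the order and absolute values, so the norm of [f x] is at
   most that of [f y], which is 0. *)
rewrite -(@normr0 _ Y) -[X in _ <= `|X|]fy.
apply: lnorm_le; rewrite -!linearN -!fjoin.
by apply/ljoin_idPr; rewrite -fjoin; congr (f _); apply/ljoin_idPr.
Qed.

(** * The closed graph theorem *)

Section ClosedGraph.
Context {R : realType} {V W : completeNormedModType R}.

(* By Baire, the closure of some {v : |f v| <= n} contains a ball. *)
Lemma approximate_preimage (f : {linear V -> W}) : exists c : R,
  forall v, exists w, `|f w| <= c * `|v| /\ `|v - w| <= `|v| / 2.
Proof.
pose A (n : nat) := closure [set v | `|f v| <= n%:R].
have [n [x [r r0 ballA]]] : exists n x, exists2 r : R, 0 < r & ball x r `<=` A n.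
  have [n] : exists n, ~ dense (~` A n).
    apply/existsNP => dA.
    have open_dense n : open (~` A n) /\ dense (~` A n).
      by split=> //; rewrite openC; exact: closed_closure.
    have [||v [_ Av]] := @Baire _ _ _ open_dense setT; [by exists 0|exact: openT|].
    apply: (Av (Num.truncn `|f v|).+1 Logic.I); apply: subset_closure => /=.
    exact/ltW/truncnS_gt.
  move=> /denseNE[B [[x /open_nbhs_nbhs/nbhs_ballP[r /= r0 xrB]] BA]].
  exists n, x, r => // y /xrB By; apply: contrapT => nAy.
  by have : (B `&` ~` A n) y by []; rewrite BA.
have approx y e : 0 < e -> A n y -> exists2 u, `|f u| <= n%:R & `|y - u| < e.
  move=> e0 /(_ (ball y e) (nbhsx_ballx _ _ e0))[u [fu]].
  by rewrite -ball_normE; exists u.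
exists (4 * n%:R / r) => v.
have [->|v0] := eqVneq v 0.
  by exists 0; rewrite linear0 subr0 !normr0 mulr0 mul0r.
have nv0 : 0 < `|v| by rewrite normr_gt0.
(* This [k] gives [k *: v] norm [r / 2], so [x + k *: v] stays in the ball. With approximants [a] of
   [x + k *: v] and [b] of [x] within [r / 8], dividing by [k] turns the bound [2n] on [f (a - b)]
   into [4n / r] times the norm of [v], and the error [r / 4] into half that norm. *)
pose k := r / (2 * `|v|).
have k0 : 0 < k by rewrite divr_gt0// mulr_gt0.
have r8 : 0 < r / 8 by rewrite divr_gt0.
have [|a fa xa] := approx (x + k *: v) _ r8.
  apply: ballA; rewrite -ball_normE /ball_/= opprD addNKr normrN normrZ gtr0_norm//.
  by rewrite /k invfM mulrA divfK ?gt_eqF// ltr_pdivrMr// ltr_pMr// ltr1n.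
have [|b fb xb] := approx x _ r8; first exact/ballA/ballxx.
exists (k^-1 *: (a - b)); split.
  have -> : 4 * n%:R / r * `|v| = k^-1 * (n%:R + n%:R).
    by rewrite /k; field; rewrite !gt_eqF.
  rewrite linearZ linearB normrZ gtr0_norm ?invr_gt0//.
  rewrite ler_wpM2l ?invr_ge0 ?(ltW k0)//.
  by rewrite (le_trans (ler_normB _ _))// lerD.
have -> : v - k^-1 *: (a - b) = k^-1 *: ((x + k *: v - a) - (x - b)).
  have -> : (x + k *: v - a) - (x - b) = k *: v - (a - b).
    by rewrite !opprB [RHS]addrA [LHS]addrC !addrA subrK [b + _]addrC.
  by rewrite [RHS]scalerBr scalerK ?gt_eqF.
rewrite normrZ gtr0_norm ?invr_gt0// ler_pdivrMl//.
have -> : k * (`|v| / 2) = r / 8 + r / 8.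
  by rewrite /k; field; rewrite !gt_eqF.
by rewrite (le_trans (ler_normB _ _))// (le_trans (lerD (ltW xa) (ltW xb))).
Qed.

(** Iterating the approximation writes [v] as a series whose image under [f] is dominated by a
    geometric series of ratio 1/2; closedness of the graph identifies the sum of the images with
    [f v]. *)
Lemma closed_graph_bounded (f : {linear V -> W}) :
  (forall (u : nat -> V) v y, u @ \oo --> v -> f \o u @ \oo --> y -> f v = y) ->
  exists c : R, forall v, `|f v| <= c * `|v|.
Proof.
move=> graphf; have [c /choice[g gP]] := approximate_preimage f.
exists (c * 2) => v.
have [->|v0] := eqVneq v 0; first by rewrite linear0 !normr0 mulr0.
have nv0 : 0 < `|v| by rewrite normr_gt0.
have c0 : 0 <= c.
  by have [gv _] := gP v; rewrite -(pmulr_lge0 _ nv0); exact: le_trans gv.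
(* [u n] is the remainder after [n] corrections; each correction halves the bound on its norm. *)
pose u := fix u n := if n is m.+1 then u m - g (u m) else v.
have u_le n : `|u n| <= geometric `|v| 2^-1 n.
  elim: n => [|n ih]; first by rewrite /= mulr1.
  have [_ /le_trans] := gP (u n); apply.
  by rewrite /= exprSr mulrA ler_pM2r ?invr_gt0.
pose w n := f (g (u n)).
have w_le n : `|w n| <= geometric (c * `|v|) 2^-1 n.
  have [/le_trans + _] := gP (u n); apply.
  by rewrite /= -mulrA ler_wpM2l//; exact: u_le.
have half1 : `|2^-1 : R| < 1 by rewrite ger0_norm ?invr_ge0// invf_lt1// ltr1n.
have cvg_norm : cvgn [normed series w].
  apply: (series_le_cvg _ _ w_le (is_cvg_geometric_series half1)) => n //.
  exact: le_trans (w_le n).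
have cvgw := normed_cvg cvg_norm.
have u0 : u @ \oo --> 0.
  apply/norm_cvg0P.
  apply: (squeeze_cvgr _ (cvg_cst 0) (@cvg_geometric _ `|v| _ half1)).
  by near=> n; rewrite normr_ge0 u_le.
(* The corrections telescope: the first [n] of them add up to [v - u n]. *)
have seriesE : series w = f \o (fun n => v - u n).
  apply/funext => n /=; elim: n => [|n ih].
    by rewrite /series /= big_geq ?subrr ?linear0.
  by rewrite seriesSr ih /= [in RHS]opprB [in RHS]addrA [in RHS]addrAC -linearD.
have -> : f v = limn (series w).
  apply: (graphf (fun n => v - u n)); last by rewrite -seriesE.
  by rewrite -[X in _ --> X]subr0; apply: cvgB => //; exact: cvg_cst.
apply: (le_trans (lim_series_norm cvg_norm)).
have /cvg_lim lim_geo := @cvg_geometric_series _ (c * `|v|) _ half1.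
have -> : c * 2 * `|v| = limn (series (geometric (c * `|v|) 2^-1)).
  by rewrite lim_geo//; field.
by apply: lim_series_le => //; exact: is_cvg_geometric_series.
Unshelve. all: by end_near. Qed.

End ClosedGraph.

(* emb is only linear: the lattice operations of F / ker proj become
   proj (emb x \/ emb y) on E. *)
Record lattice_quotient (R : realType) (E : completeNormedModType R)
    (F : banachLatticeType R) := LatticeQuotient {
  emb : {linear E -> F};
  proj : {linear F -> E};
  proj_bound : R;
  emb_norm : forall x, `|emb x| <= `|x|;
  embK : cancel emb proj;
  ker_proj_ideal : lattice_ideal (linear_kernel proj);
  proj_bounded : forall v, `|proj v| <= proj_bound * `|v|
}.
Arguments emb {R E F}.
Arguments proj {R E F}.
Arguments proj_bound {R E F}.

(* A copy of E that carries the lattice structure and the norm of F / ker proj. *)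
Definition quotient_lattice (R : realType) (E : completeNormedModType R)
  (F : banachLatticeType R) (Q : lattice_quotient R E F) : Type := E.

(** * The Banach lattice structure of [F / ker proj], carried by [E] *)

Section QuotientLattice.
Context {R : realType} {E : completeNormedModType R} {F : banachLatticeType R}.
Context (Q : lattice_quotient R E F).
Local Notation T := (quotient_lattice R E F Q).
Local Notation p := (proj Q).

HB.instance Definition _ := GRing.Lmodule.copy T E.

(** The quotient norm of [F / ker proj]: the fibre of [proj] over [x] is a coset of the kernel. *)
Definition qnorm (x : T) : R := inf [set `|v| | v in [set v | p v = x]].

Lemma qnorm_proj_le v : qnorm (p v) <= `|v|.
Proof. by apply: ge_inf; [exists 0 => _ [w _ <-]|exists v]. Qed.

Lemma le_qnorm (a : R) (x : T) :
  (forall v, p v = x -> a <= `|v|) -> a <= qnorm x.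
Proof.
move=> a_le; apply: lb_le_inf.
  (* [emb Q x] shows that the fibre is nonempty, so [inf] is a genuine greatest lower bound. *)
  by exists `|emb Q x|; exists (emb Q x) => //=; rewrite embK.
by move=> _ [v /a_le + <-].
Qed.

Lemma qnorm_le (x : T) : qnorm x <= `|x : E|.
Proof.
rewrite -{1}[x](embK _ _ _ Q).
exact: le_trans (qnorm_proj_le _) (emb_norm _ _ _ _ _).
Qed.

Lemma qnorm_ge0 x : 0 <= qnorm x.
Proof. exact: le_qnorm. Qed.

(** With [qnorm_le], this makes the two norms on [E] equivalent, whence definiteness, completeness
    and the isomorphism. The absolute value covers a [proj_bound] of any sign. *)
Lemma le_norm_qnorm (x : T) : `|x : E| <= `|proj_bound Q| * qnorm x.
Proof.
have [C0|C0] := eqVneq (proj_bound Q) 0.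
  have := proj_bounded _ _ _ Q (emb Q x).
  by rewrite C0 normr0 !mul0r embK.
rewrite -ler_pdivrMl ?normr_gt0//; apply: le_qnorm => v <-.
rewrite ler_pdivrMl ?normr_gt0//; apply: (le_trans (proj_bounded _ _ _ _ _)).
by rewrite ler_wpM2r// ler_norm.
Qed.

Lemma qnormD x y : qnorm (x + y) <= qnorm x + qnorm y.
Proof.
rewrite -lerBlDr; apply: le_qnorm => v <-; rewrite lerBlDl -lerBlDr.
apply: le_qnorm => w <-; rewrite lerBlDr addrC -(linearD p).
by apply: (le_trans (qnorm_proj_le _)); rewrite ler_normD.
Qed.

Lemma qnormZ a x : qnorm (a *: x) = `|a| * qnorm x.
Proof.
have qnormZ_le (b : R) (y : T) : b != 0 -> qnorm (b *: y) <= `|b| * qnorm y.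
  move=> b0; rewrite -ler_pdivrMl ?normr_gt0//; apply: le_qnorm => v <-.
  rewrite ler_pdivrMl ?normr_gt0// -normrZ -(linearZ_LR p).
  exact: qnorm_proj_le.
have [->|a0] := eqVneq a 0.
  rewrite normr0 mul0r scale0r; apply/le_anti; rewrite qnorm_ge0 andbT.
  by rewrite (le_trans (qnorm_le _))// normr0.
(* The reverse inequality is [qnormZ_le] for [a^-1] and [a *: x]. *)
apply/le_anti; rewrite qnormZ_le//=.
rewrite -{1}[x](scalerK a0) -ler_pdivlMl ?normr_gt0// -normfV.
by rewrite qnormZ_le// invr_eq0.
Qed.

Lemma qnorm_eq0 x : qnorm x = 0 -> x = 0.
Proof.
move=> x0; apply/(@normr0_eq0 _ E)/le_anti; rewrite normr_ge0 andbT.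
by have := le_norm_qnorm x; rewrite x0 mulr0.
Qed.

HB.instance Definition _ :=
  Lmodule_isNormed.Build R T qnormD qnormZ qnorm_eq0.

Lemma quotient_lattice_complete (G : set_system T) :
  ProperFilter G -> cauchy G -> cvg G.
Proof.
move=> GG /cauchy_ballP Gcauchy.
have /cauchy_cvg/cvg_ex[/= l Gl] : cauchy (G : set_system E).
  apply/cauchy_ballP => e e0.
  (* Adding 1 keeps the divisor positive even if [proj_bound Q] is 0. *)
  have c1 : 0 < `|proj_bound Q| + 1 by rewrite ltr_pwDr.
  have := Gcauchy (e / (`|proj_bound Q| + 1)) (divr_gt0 e0 c1).
  apply: filterS => -[x y] /=; rewrite -!ball_normE /ball_ /= ltr_pdivlMr//.
  apply: le_lt_trans; apply: (le_trans (le_norm_qnorm _)).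
  by rewrite mulrC ler_wpM2l ?qnorm_ge0 ?lerDl.
apply/cvg_ex; exists (l : T); apply/cvgrPdist_lt => e e0.
move/cvgrPdist_lt : Gl => /(_ e e0); apply: filterS => x.
exact: (le_lt_trans (qnorm_le _)).
Qed.

HB.instance Definition _ := Uniform_isComplete.Build T quotient_lattice_complete.

Definition qjoin (x y : T) : T := p (ljoin (emb Q x) (emb Q y)).
Definition qmeet (x y : T) : T := - qjoin (- x) (- y).
(** With the order read off from the join, reflexivity, antisymmetry and transitivity become
    idempotence, commutativity and associativity of [qjoin]. *)
Definition qle (x y : T) : bool := qjoin x y == y.

(** [v] and [emb Q (p v)] differ by an element of the ideal [ker p], and so do the joins. Lattice
    identities of [F] thus descend to [T]. *)
Lemma proj_ljoin (v w : F) : p (ljoin v w) = qjoin (p v) (p w).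
Proof.
apply/eqP; rewrite /qjoin -subr_eq0 -linearB; apply/eqP.
by apply: (ideal_ljoinB _ _ _ _ _ (ker_proj_ideal _ _ _ Q));
  rewrite /linear_kernel /= linearB embK subrr.
Qed.

Lemma qjoinC x y : qjoin x y = qjoin y x.
Proof. by rewrite /qjoin ljoinC. Qed.

Lemma qjoinA x y z : qjoin x (qjoin y z) = qjoin (qjoin x y) z.
Proof.
rewrite -[x](embK _ _ _ Q) -[y](embK _ _ _ Q) -[z](embK _ _ _ Q).
by rewrite -!proj_ljoin ljoinA.
Qed.

Lemma qjoinxx x : qjoin x x = x.
Proof. by rewrite /qjoin ljoinxx embK. Qed.

Lemma qjoinDr x y z : qjoin (x + z) (y + z) = qjoin x y + z.
Proof. by rewrite /qjoin !linearD /= ljoinDr linearD /= embK. Qed.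

Lemma qle_refl : reflexive qle.
Proof. by move=> x; rewrite /qle qjoinxx. Qed.

Lemma qle_anti : antisymmetric qle.
Proof. by move=> x y /andP[/eqP + /eqP]; rewrite qjoinC => -> . Qed.

Lemma qle_trans : transitive qle.
Proof. by move=> y x z /eqP xy /eqP yz; rewrite /qle -yz qjoinA xy. Qed.

Lemma qjoin_le x y z : qle (qjoin x y) z = qle x z && qle y z.
Proof.
apply/eqP/andP => [xyz|[/eqP xz /eqP yz]].
  split; apply/eqP; rewrite -xyz !qjoinA ?qjoinxx//.
  by rewrite [qjoin y x]qjoinC -(qjoinA x y y) qjoinxx.
by rewrite -qjoinA yz xz.
Qed.

Lemma qle_add x y z : qle x y -> qle (x + z) (y + z).
Proof. by move=> /eqP xy; rewrite /qle qjoinDr xy. Qed.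

Lemma qle_opp x y : qle (- x) (- y) = qle y x.
Proof.
have opp u v : qle u v -> qle (- v) (- u).
  move=> /(qle_add _ _ (- u - v)).
  by rewrite addrA subrr add0r addrCA subrr addr0.
by apply/idP/idP => /opp //; rewrite !opprK.
Qed.

Lemma le_qmeet x y z : qle z (qmeet x y) = qle z x && qle z y.
Proof.
by rewrite /qmeet -{1}[z]opprK qle_opp qjoin_le !qle_opp.
Qed.

Lemma qle_scale (a : R) x : 0 <= a -> qle 0 x -> qle 0 (a *: x).
Proof.
move=> a0 /eqP x0.
have -> : 0 = a *: (0 : T) by rewrite scaler0.
apply/eqP; rewrite -[in RHS]x0 /qjoin !linearZ /= ljoinZ// linearZ.
by rewrite linear0.
Qed.

(** Every representative [w] of [y] dominates, in absolute value, some representative [v] of [x];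
    monotonicity of the norm of [F] then compares the infima. *)
Lemma qnorm_mono x y :
  qle (qjoin x (- x)) (qjoin y (- y)) -> qnorm x <= qnorm y.
Proof.
move=> xy; apply: le_qnorm => w pw.
pose a := labs w.
have pa : p a = qjoin y (- y) by rewrite /a /labs proj_ljoin linearN pw.
(* Truncating emb x to the order interval [-a, a] does not change its class. *)
pose v := ljoin (- ljoin (- emb Q x) (- a)) (- a).
(* In the quotient, [x] already lies between [- p a] and [p a], so both truncations leave it
   unchanged. *)
have [xa ax] : qle x (p a) /\ qle (- x) (p a).
  by apply/andP; rewrite -qjoin_le pa.
have pv : p v = x.
  rewrite /v proj_ljoin !linearN /= proj_ljoin !linearN /= embK.
  rewrite -qle_opp in xa; rewrite [qjoin (- x) _]qjoinC (eqP xa) opprK qjoinC.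
  by apply/eqP; rewrite -/(qle _ _) -[X in qle _ X]opprK qle_opp.
rewrite -pv (le_trans (qnorm_proj_le _))//; apply: lnorm_le.
apply: ljoin_lub; last first.
  rewrite -[X in lle _ X]opprK lle_opp; exact: le_ljoinr.
apply: ljoin_lub; last first.
  by apply: (lle_trans _ _ _ _ (labs_ge0 w)); rewrite -oppr0 lle_opp labs_ge0.
by rewrite -[X in lle _ X]opprK lle_opp; exact: le_ljoinr.
Qed.

HB.instance Definition _ := isBanachLattice.Build R T
  qle_refl qle_anti qle_trans qjoin_le le_qmeet qle_add qle_scale qnorm_mono.

End QuotientLattice.

(** * From a complemented ideal to a Banach lattice isomorphic to [E] *)

Lemma isometry_continuous {R : realType} {V W : normedModType R}
  (f : {linear V -> W}) : (forall x, `|f x| = `|x|) -> continuous f.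
Proof.
move=> fE; apply/linear_bounded_continuous/bounded_funP => r.
by exists r => x; rewrite fE.
Qed.

Lemma lattice_quotient_isomorphism {R : realType} {E : completeNormedModType R}
    {F : banachLatticeType R} (Q : lattice_quotient R E F) :
  exists (X : banachLatticeType R) (T : {linear E -> X}), linear_isomorphism T.
Proof.
pose X : banachLatticeType R := quotient_lattice R E F Q.
have lin_id : linear (fun x : E => x : X) by [].
pose T : {linear E -> X} := HB.pack (fun x : E => x : X)
  (GRing.isLinear.Build _ _ _ _ _ lin_id).
have lin_id' : linear (fun x : X => x : E) by [].
pose S : {linear X -> E} := HB.pack (fun x : X => x : E)
  (GRing.isLinear.Build _ _ _ _ _ lin_id').
exists X, T; split.
  apply/linear_bounded_continuous/bounded_funP => r; exists r => x.
  exact/le_trans/qnorm_le.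
exists S; split=> //.
apply/linear_bounded_continuous/bounded_funP => r.
exists (`|proj_bound Q| * r) => x xr.
by apply: (le_trans (le_norm_qnorm Q x)); exact: ler_wpM2l.
Qed.

Lemma complemented_ideal_isomorphism {R : realType} {E : completeNormedModType R}
    {F : banachLatticeType R} (delta : {linear E -> F}) (I : set F) :
  (forall x, `|delta x| = `|x|) -> lattice_ideal I ->
  direct_sum (range delta) I ->
  exists (X : banachLatticeType R) (T : {linear E -> X}), linear_isomorphism T.
Proof.
move=> deltaE idI [_ [[I0 linI] closedI] disj decomp].
have ID x y : I x -> I y -> I (x + y) by rewrite -{2}[x]scale1r; exact: linI.
have IZ a x : I x -> I (a *: x) by rewrite -[_ *: _]addr0 => Ix; exact: linI.
have IB x y : I x -> I y -> I (x - y).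
  by move=> Ix Iy; apply: ID => //; rewrite -scaleN1r; exact: IZ.
have delta_I x : I (delta x) -> x = 0.
  move=> Ix; have : (range delta `&` I) (delta x) by split => //; exists x.
  by rewrite disj /= => dx; apply/normr0_eq0; rewrite -deltaE dx normr0.
have /choice[p pP] : forall v, exists e, I (v - delta e).
  move=> v; have [_ [w [[e _ <-] Iw ->]]] := decomp v.
  by exists e; rewrite addrAC subrr add0r.
(* Uniqueness of the component in [range delta]; linearity of [p], its kernel and the closed graph
   condition all reduce to it. *)
have p_eq v e : I (v - delta e) -> p v = e.
  move=> ve; apply/subr0_eq/delta_I; rewrite linearB.
  have := IB _ _ ve (pP v).
  by rewrite opprB addrC addrA subrK.
have lin_p : linear p.
  move=> a u v; apply: p_eq.
  rewrite linearP opprD addrACA -scalerBr.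
  by apply: ID => //; exact: IZ.
pose P : {linear F -> E} := HB.pack p (GRing.isLinear.Build _ _ _ _ _ lin_p).
have ker_P : linear_kernel P = I.
  apply/seteqP; split => v; rewrite /linear_kernel /=.
    by have := pP v => /[swap] ->; rewrite linear0 subr0.
  by move=> Iv; apply: p_eq; rewrite linear0 subr0.
have [C PC] : exists C : R, forall v, `|P v| <= C * `|v|.
  apply: closed_graph_bounded => u v y uv Puy; apply: p_eq.
  (* The components of [u n] in [I] converge to [v - delta y], which lies in [I] because [I] is
     closed. *)
  apply: (@closed_cvg _ _ \oo _ (fun n => u n - delta (P (u n))) I closedI).
    by near=> n; exact: pP.
  apply: cvgB => //.
  by apply: continuous_cvg Puy; exact: isometry_continuous.
have PK : cancel delta P by move=> x; apply: p_eq; rewrite subrr.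
have ker_ideal : lattice_ideal (linear_kernel P) by rewrite ker_P.
have delta_le x : `|delta x| <= `|x| by rewrite deltaE.
exact: lattice_quotient_isomorphism
  (LatticeQuotient _ _ _ delta P C delta_le PK ker_ideal PC).
Unshelve. all: by end_near. Qed.

(** * Free extensions: continuity and the direct sum decomposition *)

Lemma opnorm_fin_continuous {R : realType} {V W : normedModType R}
  (f : {linear V -> W}) : (opnorm f < +oo)%E <-> continuous f.
Proof.
split=> [fin|/linear_bounded_continuous/bounded_funP/(_ 1)[M fM]]; last first.
  apply: (@le_lt_trans _ _ M%:E); last exact: ltry.
  by apply: ge_ereal_sup => _ [x /fM ? <-]; rewrite lee_fin.
apply/linear_bounded_continuous/ex_bound.
exists (fine (opnorm f)); apply/nbhs_normP; exists 1 => //= x.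
rewrite /= sub0r normrN => /ltW x1.
have fx : ((`|f x|)%:E <= opnorm f)%E by apply: ereal_sup_ubound; exists x.
(* [fine] is faithful here: [opnorm f] is also above [-oo], as it bounds the norm of [f x]. *)
rewrite -lee_fin fineK// fin_numElt fin andbT.
exact: lt_le_trans (ltNyr _) fx.
Qed.

(** Uniqueness identifies [That] with the extension supplied by the universal property, whose
    operator norm equals that of [T] and is therefore finite. *)
Lemma free_extension_continuous {R : realType} {E : completeNormedModType R}
    {F X : banachLatticeType R} (delta : {linear E -> F})
    (T : {linear E -> X}) (That : {linear F -> X}) :
  is_free_banach_lattice delta -> continuous T -> lattice_hom That ->
  That \o delta =1 T -> continuous That.
Proof.
move=> [_ free] Tcont homThat extThat.
have [S [_ _ normS uniqS]] := free _ _ Tcont.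
have -> : That = S :> (_ -> _) by apply/funext; exact: uniqS.
by apply/opnorm_fin_continuous; rewrite normS; exact/opnorm_fin_continuous.
Qed.

Lemma closed_set1 {R : realType} {V : normedModType R} (x : V) : closed [set x].
Proof. exact/accessible_closed_set1/hausdorff_accessible/norm_hausdorff. Qed.

Lemma free_extension_direct_sum {R : realType} {E : completeNormedModType R}
    {F X : banachLatticeType R} (delta : {linear E -> F})
    (T : {linear E -> X}) (That : {linear F -> X}) :
  is_free_banach_lattice delta -> linear_isomorphism T -> lattice_hom That ->
  That \o delta =1 T -> direct_sum (range delta) (linear_kernel That).
Proof.
move=> free [Tcont [S [TK SK Scont]]] homThat extThat.
have Thatcont := free_extension_continuous _ _ _ free Tcont homThat extThat.
have delta_cont := isometry_continuous delta free.1.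
have extE x : That (delta x) = T x := extThat x.
(* As the zero set of the identity minus the projection [delta \o S \o That], the range is closed
   once that projection is continuous. *)
have rangeE : range delta = (fun v => v - delta (S (That v))) @^-1` [set 0].
  apply/seteqP; split=> [_ [x _ <-]|v /= /subr0_eq ->] /=; last by exists (S (That v)).
  by rewrite extE TK subrr.
split.
- split.
    split; first by exists 0; rewrite ?linear0.
    by move=> a _ _ [x _ <-] [y _ <-]; exists (a *: x + y); rewrite ?linearP.
  rewrite rangeE; apply: preimage_closed; last exact: closed_set1.
  move=> v _; apply: cvgB; first exact: cvg_id.
  apply: (@continuous_comp _ _ _ (S \o That) delta); last exact: delta_cont.
  by apply: continuous_comp; [exact: Thatcont|exact: Scont].
- split; first exact: (ker_lattice_hom_ideal _ homThat).1.
  by apply: preimage_closed => [v _|]; [exact: Thatcont|exact: closed_set1].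
- apply/seteqP; split=> [_ [[x _ <-]]|_ ->].
    by rewrite /linear_kernel /= extE => Tx0; rewrite -[x]TK Tx0 -(linear0 T) TK linear0.
  by split; [exists 0; rewrite ?linear0|rewrite /linear_kernel /= linear0].
- move=> v; exists (delta (S (That v))), (v - delta (S (That v))).
  split; [by exists (S (That v))| |by rewrite addrC subrK].
  by rewrite /linear_kernel /= linearB extE SK subrr.
Qed.

Theorem proposition3p3 (R : realType) (E : completeNormedModType R)
    (FBL : banachLatticeType R) (delta : {linear E -> FBL})
    (FBL_free : is_free_banach_lattice delta) :
  ((exists (X : banachLatticeType R) (T : {linear E -> X}),
      linear_isomorphism T) <->
   (exists I : set FBL,
      [/\ lattice_ideal I, closed I & direct_sum (range delta) I])) /\
  (forall (X : banachLatticeType R) (T : {linear E -> X}),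
     linear_isomorphism T ->
     forall That : {linear FBL -> X},
       lattice_hom That -> That \o delta =1 T ->
       direct_sum (range delta) (linear_kernel That)).
Proof.
split; last by move=> X T isoT That; exact: free_extension_direct_sum.
split=> [[X [T isoT]]|[I [idI _ sumI]]].
  have [That [homThat extThat _ _]] := FBL_free.2 _ T isoT.1.
  have sumT := free_extension_direct_sum _ _ _ FBL_free isoT homThat extThat.
  exists (linear_kernel That); split=> //; first exact: ker_lattice_hom_ideal.
  by have [_ []] := sumT.
exact: complemented_ideal_isomorphism FBL_free.1 idI sumI.
Qed.
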